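(* Let $K:\mathbb{R}^2\setminus\{0\}\to[0,+\infty)$ be rotationally invariant, $K(x)=K_0(|x|)$ with $K_0:(0,+\infty)\to[0,+\infty)$, suppose that $\min\{1,|x|\}\,K(x)\in L^1(\mathbb{R}^2)$, and assume that $K$ is not identically zero (i.e. $K$ is not equal to $0$ almost everywhere). Then the cross $\mathcal{C}:=\{x=(x_1,x_2)\in\mathbb{R}^2:|x_1|\ge|x_2|\}$ is not $K$-minimal for the $K$-perimeter.
   Context: For a measurable $E\subset\mathbb{R}^2$ and the ball $B_R$ of radius $R$ centered at the origin, set $$\mathrm{Per}_K(E,B_R):=\int_{E\cap B_R}\int_{\mathbb{R}^2\setminus E}K(x-y)\,dx\,dy+\int_{E\setminus B_R}\int_{B_R\setminus E}K(x-y)\,dx\,dy .$$ $E$ is a minimizer for $\mathrm{Per}_K$ in $B_R$ if $\mathrm{Per}_K(E,B_R)\le\mathrm{Per}_K(F,B_R)$ for every measurable set $F$ such that $E\setminus B_R=F\setminus B_R$. A measurable set $E\subset\mathbb{R}^2$ is $K$-minimal for the $K$-perimeter if it is a minimizer for $\mathrm{Per}_K$ in every ball $B_R$. *)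

(* Defs.v *)
From HB Require Import structures.
From mathcomp Require Import all_boot all_order all_algebra.
From mathcomp Require Import all_classical all_reals all_analysis measurable_realfun.
Import Order.TTheory GRing.Theory Num.Theory.
Import numFieldNormedType.Exports.

Set Implicit Arguments.
Unset Strict Implicit.
Unset Printing Implicit Defensive.

Local Open Scope classical_set_scope.
Local Open Scope ring_scope.

Section lebesgue_plane.
Variable R : realType.
Local Open Scope ereal_scope.

(* Borel sets only: the product sigma-algebra is not complete. *)
Definition borel_lebesgue2 :
    {measure set (measurableTypeR R * measurableTypeR R) -> \bar R} :=
  @lebesgue_measure R \x @lebesgue_measure R.

(* The carrier is R * R; the measurable sets are the Lebesgue measurable sets,
   i.e. those that are Caratheodory measurable for the outer measure induced by
   borel_lebesgue2. *)
Definition plane : measurableType (borel_lebesgue2^*%mu).-cara :=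
  caratheodory_type borel_lebesgue2^*%mu.

Definition lebesgue2 : {measure set plane -> \bar R} :=
  @completed_measure_extension _ _ _ borel_lebesgue2.

End lebesgue_plane.

Section plane_geometry.
Context {R : realType}.

(* The norm that MathComp puts on R * R is the maximum norm, hence this
   explicit Euclidean norm. *)
Definition enorm (x : R * R) : R := Num.sqrt (x.1 ^+ 2 + x.2 ^+ 2).

Definition eball (r : R) : set (plane R) := [set x | enorm x < r].

Definition cross : set (plane R) := [set x | `|x.2| <= `|x.1|].

End plane_geometry.

Section perimeter.
Context {R : realType} (K : R * R -> R).
Local Open Scope ereal_scope.

(* K is only meaningful away from 0: in both terms the two domains of
   integration are disjoint, so that K is never evaluated at 0. *)
Definition interaction (A B : set (plane R)) : \bar R :=
  \int[@lebesgue2 R]_(x in A) \int[@lebesgue2 R]_(y in B)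
    (K ((x : R * R) - (y : R * R))%R)%:E.

Definition Per (E B : set (plane R)) : \bar R :=
  interaction (E `&` B) (~` E) + interaction (E `\` B) (B `\` E).

Definition is_minimizer (E B : set (plane R)) : Prop :=
  forall F : set (plane R), measurable F -> E `\` B = F `\` B ->
    Per E B <= Per F B.

Definition K_minimal (E : set (plane R)) : Prop :=
  measurable E /\ forall r : R, (0 < r)%R -> is_minimizer E (eball r).

End perimeter.

(* Main.v *)
Require Import Defs.
From HB Require Import structures.
From mathcomp Require Import all_boot all_order all_algebra.
From mathcomp Require Import all_classical all_reals all_analysis measurable_realfun.
From mathcomp Require Import ring lra.
Import Order.TTheory GRing.Theory Num.Theory.
Import numFieldNormedType.Exports.
Local Open Scope classical_set_scope.
Local Open Scope ring_scope.

(* Let u = x.2 + x.1 and v = x.2 - x.1, so that the cross E is {u v <= 0}.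
   For m > 0 let S = {0 < u < m, 0 < v < m}, S' = - S, and compare E with
   F = E \cup S \cup S'.  The complement of F together with S' is covered by
     {u >= m, v > 0},  {0 < u < m, v >= m}  and  {u < 0, v < 0}.
   The reflections u -> m - u and v -> m - v preserve S and the kernel, and
   carry these sets (the first and third by the former, the second by the
   latter) to disjoint subsets of E.  Writing I for the interaction, this gives
   I(S, F^c) + I(S, S') <= I(S, E), and likewise for S' by central symmetry.
   As Per(F) - Per(E) = I(S \cup S', F^c) - I(S \cup S', E) and Per(E) is
   finite, minimality of E forces I(S, S') = 0 for every m.  Hence K = 0 almost
   everywhere on {u > 0, v > 0} and, K being radial, almost everywhere.

   Tonelli's theorem is only available for product sigma-algebras, hence K is
   first replaced by a Borel kernel k that is equal to it almost everywhere; then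
   I(A, B) is the integral of k(z) |{x \in A, x - z \in B}| dz. *)

Set Implicit Arguments.
Unset Strict Implicit.
Unset Printing Implicit Defensive.

(** * Completion of a sigma-finite measure *)

Section completion.
Context d (T : measurableType d) (R : realType).
Variable mu : {measure set T -> \bar R}.
Local Open Scope ereal_scope.

(** Intersecting countably many measurable covers, the [n]-th exceeding the outer measure by at most
    [1/(n+1)], attains the infimum. If the outer measure is infinite, the whole space serves. *)
Lemma mu_ext_measurable_cover (E : set T) :
  exists F, [/\ measurable F, E `<=` F & mu F <= (mu^*)%mu E].
Proof.
have [->|Eoo] := eqVneq ((mu^*)%mu E) +oo.
  by exists setT; split => //; rewrite leey.
have Efin : (mu^*)%mu E \is a fin_num.
  by rewrite ge0_fin_numE ?ltey// outer_measure_ge0.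
have cover n : exists F, [/\ measurable F, E `<=` F &
    mu F <= (mu^*)%mu E + (n.+1%:R^-1)%:E].
  have n0 : (0 < n.+1%:R^-1 :> R)%R by rewrite invr_gt0.
  have [_/= [A [mA EA] <-] muA] := lb_ereal_inf_adherent n0 Efin.
  exists (\bigcup_k A k); split => //; first exact: bigcupT_measurable.
  rewrite (le_trans _ (ltW muA))//.
  by apply: measure_sigma_subadditive => //; exact: bigcupT_measurable.
pose F n := projT1 (cid (cover n)).
have FP n : [/\ measurable (F n), E `<=` F n &
    mu (F n) <= (mu^*)%mu E + (n.+1%:R^-1)%:E] by rewrite /F; case: cid.
exists (\bigcap_n F n); split.
- by apply: bigcapT_measurable => n; have [] := FP n.
- by apply: sub_bigcap => n _; have [] := FP n.
- apply/lee_addgt0Pr => /= _/posnumP[e]; near \oo => n.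
  have [mFn _ Fn] := FP n.
  apply: (@le_trans _ _ (mu (F n))).
    rewrite le_measure ?inE//; last exact: bigcap_inf.
    by apply: bigcapT_measurable => k; have [] := FP k.
  rewrite (le_trans Fn)// leeD// lee_fin ltW//.
  by near: n; apply: near_infty_natSinv_lt.
Unshelve. all: by end_near. Qed.

Notation cT := (caratheodory_type (mu^*)%mu).
Notation cmu := (@completed_measure_extension _ _ _ mu).

Lemma completed_measureE (A : set T) : measurable A -> cmu A = mu A.
Proof. by move=> mA; rewrite /completed_measure_extension measurable_mu_extE. Qed.

(** A measurable cover of a null set of the completion is itself null. With the converse below,
    almost-everywhere statements pass freely between the two sigma-algebras. *)
Lemma completed_negligible (N : set T) :
  cmu.-negligible (N : set cT) -> mu.-negligible N.
Proof.
move=> [A [mA A0 NA]].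
have [F [mF AF muF]] := mu_ext_measurable_cover A.
exists F; split => //; last exact: subset_trans NA AF.
by apply/eqP; rewrite -measure_le0 (le_trans muF)// -[leRHS]A0.
Qed.

Lemma negligible_completed (N : set T) :
  mu.-negligible N -> cmu.-negligible (N : set cT).
Proof.
move=> [A [mA A0 NA]]; exists A; split => //.
- exact: caratheodory_measurable_mu_ext.
- by rewrite -A0; exact: completed_measureE.
Qed.

Lemma completed_measure_is_complete : measure_is_complete cmu.
Proof. exact: measure_is_complete_caratheodory. Qed.

Hypothesis sf : sigma_finite [set: T] mu.

(** Sigma-finiteness cuts [E] into pieces of finite outer measure. Each piece has a measurable cover
    with null excess, and the union of these covers is the set sought. *)
Lemma caratheodory_borel_version (E : set T) : (mu^*)%mu.-cara.-measurable E ->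
  exists2 B : set T, measurable B & mu.-negligible (E `+` B).
Proof.
move=> mE; have [G GT mG] := sf.
have cov i := mu_ext_measurable_cover (E `&` G i).
pose F i := projT1 (cid (cov i)).
have FP i : [/\ measurable (F i), E `&` G i `<=` F i &
  mu (F i) <= (mu^*)%mu (E `&` G i)] by rewrite /F; case: cid.
have mFi i : measurable (F i) by have [] := FP i.
exists (\bigcup_i F i); first exact: bigcupT_measurable.
apply: (@negligibleS _ _ _ _ (\bigcup_i (F i `\` (E `&` G i)))); last first.
  apply: negligible_bigcup => i; apply: completed_negligible.
  have [_ EF le] := FP i; have [mGi Gifin] := mG i.
  have cGi := @caratheodory_measurable_mu_ext _ _ _ mu _ mGi.
  have mX : (mu^*)%mu.-cara.-measurable (E `&` G i) by exact: measurableI.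
  have FX : F i `\` (E `&` G i) = F i `&` ~` (E `&` G i) by rewrite setDE.
  exists (F i `\` (E `&` G i)); split => //.
    by apply: measurableD => //; exact: caratheodory_measurable_mu_ext.
  have fin : (mu^*)%mu (E `&` G i) \is a fin_num.
    rewrite ge0_fin_numE ?outer_measure_ge0//.
    apply: (@le_lt_trans _ _ ((mu^*)%mu (G i))).
      by apply: le_outer_measure; exact: subIsetr.
    by rewrite measurable_mu_extE.
  (* Caratheodory's criterion for the piece, tested on its own cover. The measure of the piece is
     finite and can be cancelled, which leaves a null excess. *)
  have muF : (mu^*)%mu (F i) = (mu^*)%mu (F i `&` (E `&` G i)) +
    (mu^*)%mu (F i `&` ~` (E `&` G i)) := mX (F i).
  rewrite (setIidr EF) -FX (measurable_mu_extE mu (mFi i)) in muF.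
  apply/eqP; rewrite -measure_le0 -(@leeD2lE _ ((mu^*)%mu (E `&` G i)))//.
  by rewrite adde0 [leLHS](_ : _ = mu (F i)).
move=> x [[Ex nF]|[[i _ Fix] nE]]; last first.
  by exists i => //; split => // -[].
exfalso; apply: nF.
have : [set: T] x by [].
by rewrite GT => -[i _ Gix]; exists i => //; have [_ + _] := FP i; exact.
Qed.


(** A nonnegative [f] is the supremum, over nonnegative rationals [r], of [r] times the indicator of
    [{f > r}]. Replacing each of these countably many sets by a measurable version changes the
    supremum only on a null set. *)
Lemma caratheodory_borel_version_fun (f : cT -> \bar R) :
    measurable_fun [set: cT] f -> (forall x, 0 <= f x) ->
  exists g : T -> \bar R, [/\ measurable_fun [set: T] g, (forall x, 0 <= g x) &
    \forall x \ae mu, f x = g x].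
Proof.
move=> mf f0.
(* This enumerates the nonnegative rationals. Codes that decode to nothing yield 0, whose term in
   the supremum is 0 and does no harm. *)
pose r n : R := `|ratr (odflt 0%R (unpickle n : option rat))|%R.
pose D n : set T := [set x : T | (r n)%:E < f x].
have mD n : (mu^*)%mu.-cara.-measurable (D n).
  by rewrite -[D n]setTI; exact: (emeasurable_fun_o_infty _ mf).
have vD n := cid2 (caratheodory_borel_version (mD n)).
pose B n : set T := projT1 (vD n).
have mB n : measurable (B n) by rewrite /B; case: (vD n).
have nB n : mu.-negligible (D n `+` B n) by rewrite /B; case: (vD n).
pose h n x : \bar R := (r n * \1_(B n) x)%:E.
have h0 n x : 0 <= h n x by rewrite lee_fin mulr_ge0 ?normr_ge0.
exists (fun x => esups (h ^~ x) 0%N); split.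
- apply: measurable_fun_esups => n; apply/measurable_EFinP.
  by apply: measurable_funM => //; exact: measurable_indic.
- move=> x; apply: (le_trans (h0 0%N x)).
  by apply: ereal_sup_ubound; exists 0%N.
have := negligible_bigcup nB; apply: negligibleS.
move=> x /= fgx; apply: contrapT => xnN; apply: fgx.
have DB n : D n x <-> B n x.
  split=> [Dx|Bx]; apply: contrapT => nx; apply: xnN; exists n => //.
  - by left.
  - by right.
apply/eqP; rewrite eq_le; apply/andP; split; last first.
  apply: ub_ereal_sup => _ [n _ <-]; rewrite /h indicE.
  case: (boolP (x \in B n)) => [|_]; last by rewrite mulr0.
  by rewrite inE mulr1 => /DB /ltW.
rewrite leNgt; apply/negP => lt.
set s := esups _ _ in lt.
have s_ge n : h n x <= s by apply: ereal_sup_ubound; exists n.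
have s0 : 0 <= s := le_trans (h0 0%N x) (s_ge 0%N).
have sfin : s \is a fin_num.
  by rewrite ge0_fin_numE// (lt_le_trans lt)// leey.
(* A rational [q] strictly between the supremum [s] and [f x] would contribute the value [q > s] to
   that supremum. The real [t] stands in for [f x], which may be infinite. *)
have [t st tf] : exists2 t : R, (fine s < t)%R & t%:E <= f x.
  move: lt (f0 x); rewrite -(fineK sfin); case: (f x) => [y| |]//.
  - by rewrite lte_fin => sy _; exists y.
  - by move=> _ _; exists (fine s + 1)%R; rewrite ?leey// ltrDl.
have [q] := rat_in_itvoo st; rewrite in_itv/= => /andP[sq qt].
have rq : r (pickle q) = ratr q.
  by rewrite /r pickleK/= ger0_norm// (le_trans _ (ltW sq))// fine_ge0.
have : B (pickle q) x.
  by apply/DB; rewrite /D/= rq (lt_le_trans _ tf)// lte_fin.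
move=> Bx; have := s_ge (pickle q).
by rewrite /h indicE mem_set// mulr1 rq -(fineK sfin) lee_fin leNgt sq.
Qed.

(** The identity from the completed space to the original one is measurable and pushes the completed
    measure forward to [mu]. *)
Lemma ge0_integral_completed (g : T -> \bar R) (A : set T) :
    measurable A -> measurable_fun [set: T] g -> (forall x, 0 <= g x) ->
  \int[cmu]_(x in (A : set cT)) g x = \int[mu]_(x in A) g x.
Proof.
move=> mA mg g0.
have mid : measurable_fun [set: cT] (id : cT -> T).
  by move=> _ X mX; rewrite setTI; exact: caratheodory_measurable_mu_ext.
rewrite -[LHS](@ge0_integral_pushforward _ _ _ _ _ _ mid cmu A g)//.
  apply: eq_measure_integral => X mX _.
  exact: completed_measureE.
exact: measurable_funS mg.
Qed.

Lemma measurable_completed_ae (f : cT -> \bar R) (g : T -> \bar R) :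
    measurable_fun [set: T] g -> (\forall x \ae mu, f x = g x) ->
  measurable_fun [set: cT] f.
Proof.
move=> mg fg.
apply: (@ae_measurable_fun _ _ _ cmu completed_measure_is_complete _ g).
  apply: negligible_completed; apply: negligibleS fg => x /= + E; apply.
  by rewrite E.
by move=> _ X mX; rewrite setTI; apply: caratheodory_measurable_mu_ext;
  rewrite -[_ @^-1` _]setTI; exact: mg.
Qed.

Lemma integral_completed_ae (f : cT -> \bar R) (g : T -> \bar R) (A : set T) :
    measurable A -> measurable_fun [set: T] g -> (forall x, 0 <= g x) ->
    (\forall x \ae mu, f x = g x) ->
  \int[cmu]_(x in (A : set cT)) f x = \int[mu]_(x in A) g x.
Proof.
move=> mA mg g0 fg; rewrite -ge0_integral_completed//.
have cA : (mu^*)%mu.-cara.-measurable A by exact: caratheodory_measurable_mu_ext.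
have mf := measurable_completed_ae mg fg.
apply: ae_eq_integral => //.
- exact: measurable_funS mf.
- apply: (@measurable_funS _ _ cT _ setT) => //.
  apply: (measurable_completed_ae mg).
  by apply: (negligibleS _ (negligible_set0 mu)) => x /=.
- apply: negligible_completed; apply: negligibleS fg => x /= + E; apply.
  by rewrite E.
Qed.

End completion.

(** * Isometries preserving the plane measure *)

Section measure_preserving.
Context d (T : measurableType d) (R : realType).
Variable mu : {measure set T -> \bar R}.
Implicit Types phi psi : T -> T.
Local Open Scope ereal_scope.

Definition measure_preserving phi :=
  measurable_fun [set: T] phi /\
  forall A, measurable A -> mu (phi @^-1` A) = mu A.

Lemma measure_preserving_comp phi psi :
  measure_preserving phi -> measure_preserving psi ->
  measure_preserving (phi \o psi).
Proof.
move=> [mphi phiE] [mpsi psiE]; split; first exact: measurableT_comp.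
move=> A mA; rewrite comp_preimage psiE ?phiE//.
by rewrite -[_ @^-1` _]setTI; exact: mphi.
Qed.

Lemma measure_preserving_ae phi (P : T -> Prop) : measure_preserving phi ->
  (\forall x \ae mu, P x) -> \forall x \ae mu, P (phi x).
Proof.
move=> [mphi phiE] [N [mN N0 PN]]; exists (phi @^-1` N); split.
- by rewrite -[_ @^-1` _]setTI; exact: mphi.
- by rewrite phiE.
- by move=> x /= nP; exact: PN.
Qed.

Lemma ge0_integral_measure_preserving phi (f : T -> \bar R) :
  measure_preserving phi -> measurable_fun [set: T] f -> (forall x, 0 <= f x) ->
  \int[mu]_x f (phi x) = \int[mu]_x f x.
Proof.
move=> [mphi phiE] mf f0.
transitivity (\int[pushforward mu phi]_x f x).
  by rewrite (ge0_integral_pushforward mphi).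
by apply: eq_measure_integral => //= A mA _; exact: phiE.
Qed.

End measure_preserving.

Section line.
Context {R : realType}.
Notation mu := (@lebesgue_measure R).

Lemma measure_preserving_opp : measure_preserving mu (-%R : R -> R).
Proof. by split=> // A mA; exact: lebesgue_measureN. Qed.

(** The pushforward agrees with Lebesgue measure on half-open intervals, and these determine it. *)
Lemma measure_preserving_add (a : R) : measure_preserving mu (+%R a).
Proof.
have ma : measurable_fun [set: R] (+%R a).
  exact: measurable_funD.
split=> // A mA; apply/esym.
transitivity (pushforward mu (+%R a : _ -> measurableTypeR R) A); last by [].
apply: lebesgue_measure_unique => //= _ [[b c]] _ <-.
rewrite /pushforward.
rewrite (_ : _ @^-1` _ = `]b - a, c - a]%classic); last first.
  by apply/seteqP; split => x; rewrite /= !in_itv/= => /andP[bx xc];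
    apply/andP; split; lra.
rewrite !lebesgue_measure_itv/= !lte_fin ltrD2r.
by case: ifP => // _; rewrite -!EFinB; congr EFin; ring.
Qed.

End line.

Section borel_plane.
Context {R : realType}.
Notation mu := (@lebesgue_measure R).
Notation P2 := (measurableTypeR R * measurableTypeR R)%type.
Local Open Scope ereal_scope.

(* A name for the function underlying [borel_lebesgue2] on which the instance
   of sigma-finiteness, that the library lacks, can be declared. *)
Definition plane_measure : set P2 -> \bar R := mu \x mu.

HB.instance Definition _ := Measure.on plane_measure.

Lemma sigma_finite_plane_measure : sigma_finite [set: P2] plane_measure.
Proof.
pose I n : set R := `[(- n%:R)%R, n%:R%R]%classic.
exists (fun n => I n `*` I n).
  apply/esym; rewrite -subTset => -[x y] _.
  have B := archi_boundP (addr_ge0 (normr_ge0 x) (normr_ge0 y)).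
  exists (Num.bound (`|x| + `|y|)%R) => //; split; rewrite /I/= in_itv/= -ler_norml;
    by rewrite (le_trans _ (ltW B))// (lerDl, lerDr).
move=> n; split; first by apply: measurableX; exact: measurable_itv.
have -> : plane_measure (I n `*` I n) = mu (I n) * mu (I n).
  by apply: product_measure1E; exact: measurable_itv.
rewrite /I lebesgue_measure_itv/=.
by case: ifP => _; rewrite ?mule0 ?ltry// -EFinB -EFinM ltry.
Qed.

HB.instance Definition _ := Measure_isSigmaFinite.Build _ _ _ plane_measure
  sigma_finite_plane_measure.

End borel_plane.

Section plane_invariance.
Context {R : realType}.
Notation mu := (@lebesgue_measure R).
Notation mu2 := (@plane_measure R).
Notation P2 := (measurableTypeR R * measurableTypeR R)%type.
Local Open Scope ereal_scope.

Lemma plane_measure_unique (m : {measure set P2 -> \bar R}) :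
  (forall A B, measurable A -> measurable B -> m (A `*` B) = mu A * mu B) ->
  forall X, measurable X -> mu2 X = m X.
Proof. by move=> mE X mX; exact: product_measure_unique. Qed.

Lemma plane_measureX (A B : set (measurableTypeR R)) :
  measurable A -> measurable B -> mu2 (A `*` B) = mu A * mu B.
Proof. exact: product_measure1E. Qed.

(** The pushforward takes the product value on rectangles, and rectangles determine the product
    measure. The next lemma follows the same pattern. *)
Lemma measure_preserving_swap : measure_preserving mu2 (fun x => (x.2, x.1)).
Proof.
have ms : measurable_fun [set: P2] (fun x : P2 => (x.2, x.1) : P2).
  exact: measurable_fun_pair.
split=> // A mA; apply/esym.
transitivity (pushforward mu2 (fun x : P2 => (x.2, x.1) : P2) A); last by [].
apply: plane_measure_unique => // B C mB mC.
transitivity (mu2 (C `*` B)); last by rewrite plane_measureX// muleC.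
by congr (mu2 _); apply/seteqP; split => x [].
Qed.

Lemma measure_preserving_pair (f g : R -> R) :
  measure_preserving mu f -> measure_preserving mu g ->
  measure_preserving mu2 (fun x => (f x.1, g x.2)).
Proof.
move=> [mf fE] [mg gE].
have ms : measurable_fun [set: P2] (fun x : P2 => (f x.1, g x.2) : P2).
  by apply: measurable_fun_pair; exact: measurableT_comp.
split=> // A mA; apply/esym.
transitivity (pushforward mu2 (fun x : P2 => (f x.1, g x.2) : P2) A); last by [].
apply: plane_measure_unique => // B C mB mC.
transitivity (mu2 ((f @^-1` B) `*` (g @^-1` C))).
  by congr (mu2 _); apply/seteqP; split => x [].
rewrite plane_measureX ?fE ?gE//.
- by rewrite -[_ @^-1` _]setTI; exact: mf.
- by rewrite -[_ @^-1` _]setTI; exact: mg.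
Qed.

Lemma measure_preserving_opp2 : measure_preserving mu2 (fun x : R * R => - x)%R.
Proof. exact: measure_preserving_pair measure_preserving_opp measure_preserving_opp. Qed.

Lemma measure_preserving_add2 (a : R * R) : measure_preserving mu2 (fun x => a + x)%R.
Proof.
exact: measure_preserving_pair (measure_preserving_add a.1)
  (measure_preserving_add a.2).
Qed.

Lemma measurable_sub2 :
  measurable_fun [set: P2 * P2] (fun p => (p.1 : R * R) - p.2 : P2)%R.
Proof.
apply: measurable_fun_pair => /=; apply: measurable_funB; do 2?exact: measurableT_comp.
Qed.

End plane_invariance.

(** * Interactions for a Borel kernel *)

Section overlap.
Context {R : realType}.
Notation mu2 := (@plane_measure R).
Notation P2 := (measurableTypeR R * measurableTypeR R)%type.
Local Open Scope ereal_scope.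
Implicit Types A B : set P2.

(** The cross-covariogram of [A] and [B]: the measure of the intersection of [A] with the translate
    [z + B]. *)
Definition overlap A B (z : P2) : \bar R := mu2 [set x : P2 | A x /\ B (x - z)%R].

Lemma measurable_subr (z : R * R) : measurable_fun [set: P2] (fun x : P2 => (x : R * R) - z : P2)%R.
Proof.
rewrite (_ : (fun _ => _) = (fun x => - z + x)%R); last by apply/funext => x; rewrite addrC.
by have [] := measure_preserving_add2 (- z)%R.
Qed.

Lemma measurable_overlap_set A B z : measurable A -> measurable B ->
  measurable [set x : P2 | A x /\ B (x - z)%R].
Proof.
move=> mA mB; apply: measurableI => //.
by rewrite -[X in measurable X]setTI; exact: measurable_subr.
Qed.

Lemma overlap_ge0 A B z : 0 <= overlap A B z.
Proof. exact: measure_ge0. Qed.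

Lemma measurable_overlap_graph A B : measurable A -> measurable B ->
  measurable [set p : P2 * P2 | A p.2 /\ B ((p.2 : R * R) - p.1)%R].
Proof.
move=> mA mB; apply: measurableI.
  by rewrite -[X in measurable X]setTI; exact: measurable_snd.
have ms : measurable_fun [set: P2 * P2] (fun p : P2 * P2 => (p.2 : R * R) - p.1 : P2)%R.
  exact: (measurableT_comp measurable_sub2 (@measurable_swap _ _ P2 P2)).
by rewrite -[X in measurable X]setTI; exact: ms.
Qed.

Lemma measurable_overlap A B : measurable A -> measurable B ->
  measurable_fun [set: P2] (overlap A B).
Proof.
move=> mA mB.
have := measurable_fun_xsection mu2 (measurable_overlap_graph mA mB).
apply: eq_measurable_fun => z _ /=; congr (mu2 _).
by apply/seteqP; split => x; rewrite /xsection/= inE.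
Qed.

Lemma overlap_addr A B B' z : measurable A -> measurable B -> measurable B' ->
  B `&` B' = set0 -> overlap A (B `|` B') z = overlap A B z + overlap A B' z.
Proof.
move=> mA mB mB' BB'; rewrite /overlap -measureU//.
- congr (mu2 _); apply/seteqP; split => x /=.
  + by move=> [Ax [|]]; [left|right].
  + by move=> [[]|[]] Ax Bx; split=> //; [left|right].
- exact: measurable_overlap_set.
- exact: measurable_overlap_set.
- rewrite -subset0 => x [/= [_ Bx] [_ B'x]].
  by have : (B `&` B') (x - z)%R by []; rewrite BB'.
Qed.

Lemma le_overlap A A' B B' z : measurable A -> measurable A' -> measurable B ->
  measurable B' -> A `<=` A' -> B `<=` B' -> overlap A B z <= overlap A' B' z.
Proof.
move=> mA mA' mB mB' AA' BB'; apply: le_measure.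
- by rewrite inE; exact: measurable_overlap_set.
- by rewrite inE; exact: measurable_overlap_set.
- by move=> x /= [Ax Bx]; split; [exact: AA' | exact: BB'].
Qed.

Lemma overlapC A B z : measurable A -> measurable B ->
  overlap A B (- z)%R = overlap B A z.
Proof.
move=> mA mB; have [_ pE] := measure_preserving_add2 (- z)%R.
rewrite /overlap -(pE [set x : P2 | A x /\ B (x - - z)%R]); last first.
  exact: measurable_overlap_set.
congr (mu2 _); apply/seteqP; split => x /=; rewrite opprK (addrC (- z)%R) subrK => -[]; by split.
Qed.

(** Here [phi] is to be thought of as an affine map and [lam] as its linear part, which acts on
    differences of points. *)
Lemma overlap_preimage A B z (phi lam : P2 -> P2) :
  measure_preserving mu2 phi -> measurable A -> measurable B ->
  (forall x y : R * R, phi (x - y)%R = ((phi x : R * R) - lam y)%R) ->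
  overlap (phi @^-1` A) (phi @^-1` B) z = overlap A B (lam z).
Proof.
move=> [_ pE] mA mB philam; rewrite /overlap -[RHS]pE.
  by congr (mu2 _); apply/seteqP; split => x /=; rewrite philam.
exact: measurable_overlap_set.
Qed.

End overlap.

Section kernel.
Context {R : realType}.
Notation mu2 := (@plane_measure R).
Notation P2 := (measurableTypeR R * measurableTypeR R)%type.
Local Open Scope ereal_scope.
Variable k : P2 -> \bar R.
Hypotheses (mk : measurable_fun [set: P2] k) (k0 : forall z, 0 <= k z).
Implicit Types A B : set P2.

Definition kernel_interaction A B := \int[mu2]_z (k z * overlap A B z).
Notation J := kernel_interaction.

Let mko A B : measurable A -> measurable B ->
  measurable_fun [set: P2] (fun z => k z * overlap A B z).
Proof. by move=> mA mB; apply: emeasurable_funM => //; exact: measurable_overlap. Qed.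

Let ko0 A B z : 0 <= k z * overlap A B z.
Proof. by rewrite mule_ge0// overlap_ge0. Qed.

Lemma kernel_interaction_ge0 A B : 0 <= J A B.
Proof. by apply: integral_ge0 => z _. Qed.

Lemma kernel_interaction_addr A B B' :
  measurable A -> measurable B -> measurable B' ->
  B `&` B' = set0 -> J A (B `|` B') = J A B + J A B'.
Proof.
move=> mA mB mB' BB'; rewrite /J -ge0_integralD//; try exact: mko.
by apply: eq_integral => z _; rewrite overlap_addr// ge0_muleDr ?overlap_ge0.
Qed.

Lemma le_kernel_interaction A A' B B' :
  measurable A -> measurable A' -> measurable B -> measurable B' ->
  A `<=` A' -> B `<=` B' -> J A B <= J A' B'.
Proof.
move=> mA mA' mB mB' AA' BB'; apply: ge0_le_integral.
- exact: measurableT.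
- by move=> z _; exact: ko0.
- exact: mko.
- exact: mko.
- by move=> z _; apply: lee_wpmul2l; [exact: k0 | exact: le_overlap].
Qed.

(** Substitute [lam z] for [z] in the integral. The kernel matters only up to a null set, so its
    invariance under [lam] is asked almost everywhere. *)
Lemma kernel_interaction_preimage A B (phi lam : P2 -> P2) :
  measure_preserving mu2 phi -> measure_preserving mu2 lam ->
  (\forall z \ae mu2, k (lam z) = k z) ->
  (forall x y : R * R, phi (x - y)%R = ((phi x : R * R) - lam y)%R) ->
  measurable A -> measurable B -> J (phi @^-1` A) (phi @^-1` B) = J A B.
Proof.
move=> pphi plam klam philam mA mB; rewrite /J.
have mphi X : measurable X -> measurable (phi @^-1` X).
  by move=> mX; rewrite -[_ @^-1` _]setTI; apply: pphi.1.
transitivity (\int[mu2]_z (k (lam z) * overlap A B (lam z))); last first.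
  exact: (ge0_integral_measure_preserving plam (mko mA mB) (ko0 A B)).
apply: ge0_ae_eq_integral => //.
- by apply: mko; exact: mphi.
- by apply: (measurableT_comp (mko mA mB)); exact: plam.1.
- by apply: filterS klam => z klam _; rewrite klam (overlap_preimage _ pphi mA mB philam).
Qed.

Lemma kernel_interactionC A B : {ae mu2, forall z : P2, k (- (z : R * R))%R = k z} ->
  measurable A -> measurable B -> J A B = J B A.
Proof.
move=> kN mA mB; rewrite /J.
transitivity (\int[mu2]_z (k (- z)%R * overlap A B (- z)%R)).
  apply/esym; exact: (ge0_integral_measure_preserving measure_preserving_opp2
    (mko mA mB) (ko0 A B)).
apply: ge0_ae_eq_integral => //.
- by apply: (measurableT_comp (mko mA mB)); exact: measure_preserving_opp2.1.
- exact: mko.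
- by apply: filterS kN => z kN _; rewrite kN overlapC.
Qed.

(** Substitute [y = x - z] in the inner integral and exchange the two integrals by Tonelli; the
    integral in [x] then measures the overlap at [z]. *)
Lemma interactionE (K : R * R -> R) A B :
  (\forall z \ae mu2, (K z)%:E = k z) -> measurable A -> measurable B ->
  interaction K A B = J A B.
Proof.
move=> Kk mA mB; rewrite /interaction.
pose h (x : P2) := \int[mu2]_z (k z * (\1_B ((x : R * R) - z)%R)%:E).
have p x : measure_preserving mu2 (fun y => x - y)%R.
  exact: measure_preserving_comp (measure_preserving_add2 x) measure_preserving_opp2.
have mB1 : measurable_fun [set: P2] (fun x => (\1_B x)%:E : \bar R).
  by apply/measurable_EFinP; exact: measurable_indic.
have mF : measurable_fun [set: P2 * P2]
    (fun q => k q.2 * (\1_B ((q.1 : R * R) - q.2)%R)%:E).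
  apply: emeasurable_funM; first exact: measurableT_comp.
  exact: (measurableT_comp mB1 measurable_sub2).
have F0 x z : 0 <= k z * (\1_B ((x : R * R) - z)%R)%:E by rewrite mule_ge0// lee_fin.
have inner (x : P2) :
    \int[@lebesgue2 R]_(y in B) (K ((x : R * R) - (y : R * R))%R)%:E = h x.
  (* The map [y -> x - y] pulls null sets back to null sets, so [K] may be replaced by [k] for every
     [x], not just for almost every one. *)
  transitivity (\int[mu2]_(y in B) k ((x : R * R) - y)%R).
    apply: (@integral_completed_ae _ _ _ (borel_lebesgue2 R)) => //.
    - by apply: (measurableT_comp mk); exact: (p x).1.
    - exact: (measure_preserving_ae (p x) Kk).
  have mhx : measurable_fun [set: P2] (fun z => k z * (\1_B ((x : R * R) - z)%R)%:E).
    apply: emeasurable_funM => //.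
    by apply: (measurableT_comp mB1); exact: (p x).1.
  rewrite /h -[RHS](ge0_integral_measure_preserving (p x) mhx (F0 x)).
  rewrite [LHS]integral_mkcond; apply: eq_integral => y _.
  rewrite subKr patchE indicE; case: ifP => _; by rewrite ?mule1 ?mule0.
under eq_integral do rewrite inner.
rewrite (@ge0_integral_completed _ _ _ (borel_lebesgue2 R))//; last 2 first.
- exact: (measurable_fun_fubini_tonelli_F _ mF).
- by move=> x; exact: integral_ge0.
(* Putting the condition on [x] into the indicator as well makes both integrals range over the whole
   plane, and the section of [S] at [z] is the overlap set. *)
pose S := [set q : P2 * P2 | A q.2 /\ B ((q.2 : R * R) - q.1)%R].
have mS : measurable S by exact: measurable_overlap_graph.
transitivity (\int[mu2]_x \int[mu2]_z (k z * (\1_S (z, x))%:E)).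
  rewrite integral_mkcond; apply: eq_integral => x _.
  rewrite patchE; case: ifPn => xA.
    apply: eq_integral => z _; congr (_ * (_)%:E).
    rewrite !indicE; congr ((nat_of_bool _)%:R); apply/idP/idP; rewrite !inE.
    + by split=> //; rewrite inE in xA.
    + by case.
  rewrite integral0_eq// => z _; rewrite indicE memNset ?mule0// => -[Ax _].
  by move: xA; rewrite notin_setE.
pose G (q : P2 * P2) := k q.2 * (\1_S (q.2, q.1))%:E.
have mG : measurable_fun [set: P2 * P2] G.
  apply: emeasurable_funM; first exact: measurableT_comp.
  apply/measurable_EFinP.
  apply: (measurableT_comp (measurable_indic mS)).
  exact: (@measurable_swap _ _ P2 P2).
have G0 q : 0 <= G q by rewrite mule_ge0// lee_fin.
transitivity (\int[mu2]_z \int[mu2]_x G (x, z)).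
  exact: (@fubini_tonelli _ _ _ _ _ mu2 mu2 G mG G0).
rewrite /G/=.
apply: eq_integral => z _.
have mSz : measurable_fun [set: P2] (fun x => (\1_S (z, x))%:E : \bar R).
  apply/measurable_EFinP; apply: (measurableT_comp (measurable_indic mS)).
  exact: measurable_fun_pair.
transitivity (k z * \int[mu2]_x (\1_S (z, x))%:E).
  by apply: ge0_integralZl => // x _; rewrite lee_fin.
congr (_ * _); rewrite /overlap.
pose X := [set x : P2 | A x /\ B ((x : R * R) - z)%R].
transitivity (\int[mu2]_x (\1_X x)%:E) => //.
by rewrite integral_indic// ?setIT//; exact: measurable_overlap_set.
Qed.

End kernel.

(** * Filling the corners of the cross *)

Section quadrants.
Context {R : realType}.
Notation mu2 := (@plane_measure R).
Notation P2 := (measurableTypeR R * measurableTypeR R)%type.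
Implicit Types (m : R) (U V : set R).

(* The half-lines bounding the cross are the axes of the coordinates
   [x.2 + x.1] and [x.2 - x.1]. *)
Definition rect U V : set P2 := [set x | U (x.2 + x.1) /\ V (x.2 - x.1)].

Lemma measurable_rect U V : measurable U -> measurable V -> measurable (rect U V).
Proof.
move=> mU mV; apply: measurableI.
- have ms : measurable_fun [set: P2] (fun x : P2 => x.2 + x.1 : R).
    by apply: measurable_funD.
  by rewrite -[X in measurable X]setTI; exact: ms.
- have ms : measurable_fun [set: P2] (fun x : P2 => x.2 - x.1 : R).
    by apply: measurable_funB.
  by rewrite -[X in measurable X]setTI; exact: ms.
Qed.

(** In the coordinates [u = x.2 + x.1] and [v = x.2 - x.1], [refl1] sends [u] to [m - u] and fixes
    [v], whereas [refl2] fixes [u] and sends [v] to [m - v]. *)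
Definition refl1 m (x : P2) : P2 := (m / 2 - x.2, m / 2 - x.1).
Definition refl2 m (x : P2) : P2 := (x.2 - m / 2, x.1 + m / 2).

Lemma measure_preserving_refl1 m : measure_preserving mu2 (refl1 m).
Proof.
exact: (measure_preserving_comp (measure_preserving_add2 (m / 2, m / 2))
  (measure_preserving_comp measure_preserving_opp2 (@measure_preserving_swap R))).
Qed.

Lemma measure_preserving_refl2 m : measure_preserving mu2 (refl2 m).
Proof.
have := measure_preserving_comp (measure_preserving_add2 (- (m / 2), m / 2))
  (@measure_preserving_swap R).
rewrite (_ : _ \o _ = refl2 m)//; apply/funext => x.
by rewrite /refl2 (addrC x.1) (addrC x.2).
Qed.

Lemma refl1_rect m U V : refl1 m @^-1` rect U V = rect [set t | U (m - t)] V.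
Proof.
have E1 (x : P2) : m / 2 - x.1 + (m / 2 - x.2) = m - (x.2 + x.1) by field.
have E2 (x : P2) : m / 2 - x.1 - (m / 2 - x.2) = x.2 - x.1 by ring.
by apply/seteqP; split => x; rewrite /rect/refl1/= E1 E2.
Qed.

Lemma refl2_rect m U V : refl2 m @^-1` rect U V = rect U [set t | V (m - t)].
Proof.
have E1 (x : P2) : x.1 + m / 2 + (x.2 - m / 2) = x.2 + x.1 by ring.
have E2 (x : P2) : x.1 + m / 2 - (x.2 - m / 2) = m - (x.2 - x.1) by field.
by apply/seteqP; split => x; rewrite /rect/refl2/= E1 E2.
Qed.

Definition square m : set P2 := rect `]0, m[%classic `]0, m[%classic.

Lemma measurable_square m : measurable (square m).
Proof. by apply: measurable_rect; exact: measurable_itv. Qed.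

Lemma refl_itv m : [set t | `]0, m[%classic (m - t)] = `]0, m[%classic.
Proof.
by apply/seteqP; split => t; rewrite /= !in_itv/= => /andP[? ?];
  apply/andP; split; lra.
Qed.

Lemma measurable_cross : measurable (cross : set P2).
Proof.
rewrite -[X in measurable X]setTI.
have mf : measurable_fun [set: P2] (fun x : P2 => `|x.2| <= `|x.1|).
  by apply: measurable_fun_ler; apply: measurableT_comp.
exact: (mf _ [set true]).
Qed.

Lemma measurable_enorm : measurable_fun [set: P2] (@enorm R).
Proof.
apply: (measurableT_comp (f := @Num.sqrt R)).
  by apply: continuous_measurable_fun; exact: sqrt_continuous.
by apply: measurable_funD; apply: measurable_funX.
Qed.

Lemma measurable_eball r : measurable (@eball R r : set P2).
Proof.
rewrite -[X in measurable X]setTI.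
have mf : measurable_fun [set: P2] (fun x : P2 => enorm x < r).
  by apply: measurable_fun_ltr => //; exact: measurable_enorm.
exact: (mf _ [set true]).
Qed.

Lemma not_cross_quadrant (x : P2) : ~ cross x ->
  (0 < x.2 + x.1 /\ 0 < x.2 - x.1) \/ (x.2 + x.1 < 0 /\ x.2 - x.1 < 0).
Proof.
rewrite /cross/= => /negP; rewrite -ltNge => h.
have [x20|x20] := leP 0 x.2.
- left; move: h; rewrite (ger0_norm x20) ltr_norml => /andP[? ?]; split; lra.
- right; move: h; rewrite (ltr0_norm x20) ltr_norml => /andP[? ?]; split; lra.
Qed.

Lemma cross_le0_ge0 (x : P2) : x.2 + x.1 <= 0 -> 0 <= x.2 - x.1 -> cross x.
Proof.
move=> h1 h2; rewrite /cross/= (ler0_norm (_ : x.1 <= 0)); last by lra.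
by rewrite ler_norml; apply/andP; split; lra.
Qed.

Lemma cross_ge0_le0 (x : P2) : 0 <= x.2 + x.1 -> x.2 - x.1 <= 0 -> cross x.
Proof.
move=> h1 h2; rewrite /cross/= (ger0_norm (_ : 0 <= x.1)); last by lra.
by rewrite ler_norml; apply/andP; split; lra.
Qed.

End quadrants.

(** * The interaction inequality for the corner squares *)

Section energy_gap.
Context {R : realType}.
Notation mu2 := (@plane_measure R).
Notation P2 := (measurableTypeR R * measurableTypeR R)%type.
Local Open Scope ereal_scope.
Variable k : P2 -> \bar R.
Hypotheses (mk : measurable_fun [set: P2] k) (k0 : forall z, 0 <= k z).
Hypothesis kN : {ae mu2, forall z : P2, k (- (z : R * R))%R = k z}.
Hypothesis kS : {ae mu2, forall z : P2, k (z.2, z.1) = k z}.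
Variable m : R.
Notation J := (kernel_interaction k).
Implicit Types U V : set R.

(** The map [z -> (- z.2, - z.1)] is the linear part of [refl1]. *)
Let kNS : {ae mu2, forall z : P2, k (- z.2, - z.1)%R = k z}.
Proof.
have := measure_preserving_ae (@measure_preserving_swap R) kN.
by move: kS; apply: filterS2 => z /= <- <-.
Qed.

(** The reflection maps the square onto itself, so only the second set moves. *)
Lemma kernel_interaction_refl1 U V : measurable U -> measurable V ->
  J (square m) (rect U V) = J (square m) (rect [set t | U (m - t)%R] V).
Proof.
move=> mU mV; rewrite -refl1_rect.
have {2}<- : refl1 m @^-1` square m = square m.
  by rewrite refl1_rect; congr rect; exact: refl_itv.
apply/esym; apply: (kernel_interaction_preimage mk k0 (measure_preserving_refl1 m)
   (measure_preserving_comp measure_preserving_opp2 (@measure_preserving_swap R))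
   kNS).
- by move=> x y; rewrite /refl1; congr pair => /=; ring.
- exact: measurable_square.
- exact: measurable_rect.
Qed.

Lemma kernel_interaction_refl2 U V : measurable U -> measurable V ->
  J (square m) (rect U V) = J (square m) (rect U [set t | V (m - t)%R]).
Proof.
move=> mU mV; rewrite -refl2_rect.
have {2}<- : refl2 m @^-1` square m = square m.
  by rewrite refl2_rect; congr rect; exact: refl_itv.
apply/esym; apply: (kernel_interaction_preimage mk k0 (measure_preserving_refl2 m)
   (@measure_preserving_swap R) kS).
- by move=> x y; rewrite /refl2; congr pair => /=; ring.
- exact: measurable_square.
- exact: measurable_rect.
Qed.

Lemma kernel_interaction_opp (A B : set P2) : measurable A -> measurable B ->
  J ((-%R : R * R -> R * R) @^-1` A) ((-%R : R * R -> R * R) @^-1` B) = J A B.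
Proof.
move=> mA mB; apply: (kernel_interaction_preimage mk k0 measure_preserving_opp2
   measure_preserving_opp2 kN) => // x y.
by rewrite opprB opprK addrC.
Qed.

Definition nsquare : set P2 := (-%R : R * R -> R * R) @^-1` square m.
Notation S := (square m).
Notation S' := nsquare.
Definition filled_cross : set P2 := cross `|` (S `|` S').
Notation F := filled_cross.

Lemma measurable_nsquare : measurable S'.
Proof.
rewrite -[X in measurable X]setTI; apply: measure_preserving_opp2.1 => //.
exact: measurable_square.
Qed.

Lemma measurable_filled_cross : measurable F.
Proof.
apply: measurableU; first exact: measurable_cross.
apply: measurableU; [exact: measurable_square | exact: measurable_nsquare].
Qed.

Hypothesis m0 : (0 < m)%R.

Lemma square_gap : J S (~` F) + J S S' <= J S cross.
Proof.
have mS := measurable_square m; have mS' := measurable_nsquare.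
have mF := measurable_filled_cross.
have mcr : measurable (cross : set P2) := measurable_cross.
(* [Q1], [Q2] and [Q3] cover the complement of [F] together with [S']. The primed sets are their
   reflections: [Q1] and [Q3] in [u], [Q2] in [v]. *)
pose Q1 : set P2 := rect `[m, +oo[%classic `]0%R, +oo[%classic.
pose Q2 : set P2 := rect `]0%R, m[%classic `[m, +oo[%classic.
pose Q3 : set P2 := rect `]-oo, 0%R[%classic `]-oo, 0%R[%classic.
pose Q1' : set P2 := rect `]-oo, 0%R]%classic `]0%R, +oo[%classic.
pose Q2' : set P2 := rect `]0%R, m[%classic `]-oo, 0%R]%classic.
pose Q3' : set P2 := rect `]m, +oo[%classic `]-oo, 0%R[%classic.
have mr (i j : interval R) : measurable (rect [set` i] [set` j]).
  by apply: measurable_rect; exact: measurable_itv.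
have e1 : [set t : R | (`[m, +oo[%classic : set R) (m - t)%R] = `]-oo, 0%R]%classic.
  by apply/seteqP; split => t; rewrite /= !in_itv/= ?andbT; lra.
have JQ1 : J S Q1 = J S Q1'.
  apply: etrans (congr1 (fun W => J S (rect W `]0%R, +oo[%classic)) e1).
  exact: (kernel_interaction_refl1 (measurable_itv `[m, +oo[) (measurable_itv `]0%R, +oo[)).
have e2 : [set t : R | (`[m, +oo[%classic : set R) (m - t)%R] = `]-oo, 0%R]%classic.
  by apply/seteqP; split => t; rewrite /= !in_itv/= ?andbT; lra.
have JQ2 : J S Q2 = J S Q2'.
  apply: etrans (congr1 (fun W => J S (rect `]0%R, m[%classic W)) e2).
  exact: (kernel_interaction_refl2 (measurable_itv `]0%R, m[) (measurable_itv `[m, +oo[)).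
have e3 : [set t : R | (`]-oo, 0%R[%classic : set R) (m - t)%R] = `]m, +oo[%classic.
  by apply/seteqP; split => t; rewrite /= !in_itv/= ?andbT; lra.
have JQ3 : J S Q3 = J S Q3'.
  apply: etrans (congr1 (fun W => J S (rect W `]-oo, 0%R[%classic)) e3).
  exact: (kernel_interaction_refl1 (measurable_itv `]-oo, 0%R[) (measurable_itv `]-oo, 0%R[)).
have [mQ1 mQ2 mQ3] : [/\ measurable Q1, measurable Q2 & measurable Q3].
  by split; exact: mr.
have [mQ1' mQ2' mQ3'] : [/\ measurable Q1', measurable Q2' & measurable Q3'].
  by split; exact: mr.
have mQ12 := measurableU _ _ mQ1 mQ2.
have mQ12' := measurableU _ _ mQ1' mQ2'.
have mQ := measurableU _ _ mQ12 mQ3.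
have mQ' := measurableU _ _ mQ12' mQ3'.
have FS' : ~` F `&` S' = set0.
  by rewrite -subset0 => x [/= nF S'x]; apply: nF; right; right.
(* As [S'] lies in [F], the two terms on the left merge into one interaction with a disjoint
   union. *)
rewrite -(kernel_interaction_addr mk k0 mS (measurableC mF) mS' FS').
apply: (@le_trans _ _ (J S (Q1 `|` Q2 `|` Q3))).
  apply: (le_kernel_interaction mk k0 mS mS
    (measurableU _ _ (measurableC mF) mS') mQ (@subset_refl _ _)).
  move=> x [/= nF|].
  - have [ncr nS] : ~ cross x /\ ~ S x by split=> ?; apply: nF; [left|right; left].
    (* Outside the cross [u] and [v] have the same strict sign. Both negative gives [Q3]; if both
       are positive, a point outside [S] has [u >= m] or [v >= m]. *)
    have [[u0 v0]|[u0 v0]] := not_cross_quadrant ncr; last first.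
      by right; split; rewrite /= in_itv/=.
    left; have [um|um] := leP m (x.2 + x.1)%R.
      by left; split; rewrite /= in_itv/= ?um ?v0.
    have vm : (m <= x.2 - x.1)%R.
      rewrite leNgt; apply/negP => vm.
      by apply: nS; split; rewrite /= in_itv/= ?u0 ?um ?v0 ?vm.
    by right; split; rewrite /= in_itv/= ?u0 ?um ?vm.
  - rewrite /nsquare /square/rect/= !in_itv/= => -[/andP[? ?] /andP[? ?]].
    by right; split; rewrite /= in_itv/=; lra.
have d12 : Q1 `&` Q2 = set0.
  by rewrite -subset0 => x; rewrite /Q1/Q2/rect/= !in_itv/= ?andbT; lra.
have d123 : (Q1 `|` Q2) `&` Q3 = set0.
  by rewrite -subset0 => x; rewrite /Q1/Q2/Q3/rect/= !in_itv/= ?andbT; lra.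
have d12' : Q1' `&` Q2' = set0.
  by rewrite -subset0 => x; rewrite /Q1'/Q2'/rect/= !in_itv/= ?andbT; lra.
have d123' : (Q1' `|` Q2') `&` Q3' = set0.
  by rewrite -subset0 => x; rewrite /Q1'/Q2'/Q3'/rect/= !in_itv/= ?andbT; lra.
rewrite (kernel_interaction_addr mk k0 mS mQ12 mQ3 d123).
rewrite (kernel_interaction_addr mk k0 mS mQ1 mQ2 d12).
rewrite JQ1 JQ2 JQ3.
rewrite -(kernel_interaction_addr mk k0 mS mQ1' mQ2' d12').
rewrite -(kernel_interaction_addr mk k0 mS mQ12' mQ3' d123').
apply: (le_kernel_interaction mk k0 mS mS mQ' mcr (@subset_refl _ _)).
move=> x; rewrite /Q1'/Q2'/Q3'/rect/= !in_itv/= ?andbT => -[[]|] [h1 h2].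
- by apply: cross_le0_ge0; lra.
- by apply: cross_ge0_le0; lra.
(* Positivity of [m] is what places the reflection [{u > m, v < 0}] of the opposite quadrant inside
   the cross. *)
- by apply: cross_ge0_le0; move: m0 h1 h2; lra.
Qed.

(** Split both sides over [S] and [S']. The full [square_gap] handles [S]; central symmetry carries
    it over to [S'], where the extra term is dropped. *)
Lemma energy_gap : J (S `|` S') (~` F) + J S S' <= J (S `|` S') cross.
Proof.
have mS := measurable_square m; have mS' := measurable_nsquare.
have mF := measurable_filled_cross; have mFC := measurableC mF.
have mcr : measurable (cross : set P2) := measurable_cross.
have mSS' := measurableU _ _ mS mS'.
have SS' : S `&` S' = set0.
  by rewrite -subset0 => x; rewrite /nsquare/square/rect/= !in_itv/=; lra.
have addl X : measurable X -> J (S `|` S') X = J S X + J S' X.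
  move=> mX; rewrite (kernel_interactionC mk k0 kN mSS' mX).
  rewrite (kernel_interaction_addr mk k0 mX mS mS' SS').
  rewrite (kernel_interactionC mk k0 kN mS mX).
  by rewrite (kernel_interactionC mk k0 kN mS' mX).
have oppS : ((-%R : R * R -> R * R) @^-1` S' : set P2) = S.
  by apply/seteqP; split => x; rewrite /nsquare/= opprK.
have oppcr : ((-%R : R * R -> R * R) @^-1` cross : set P2) = cross.
  by apply/seteqP; split => x; rewrite /cross/= !normrN.
have oppF : ((-%R : R * R -> R * R) @^-1` (~` F) : set P2) = ~` F.
  apply/seteqP; split => x /= nF [crx|[Sx|S'x]]; apply: nF.
  - by left; rewrite /cross/= !normrN.
  - by right; right; rewrite /nsquare/= opprK.
  - by right; left.
  - by left; move: crx; rewrite /cross/= !normrN.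
  - by right; right.
  - by right; left; move: S'x; rewrite /nsquare/= opprK.
rewrite (addl _ mFC) (addl _ mcr) addeAC; apply: leeD; first exact: square_gap.
rewrite -(kernel_interaction_opp mS' mFC) -(kernel_interaction_opp mS' mcr).
rewrite oppS oppcr oppF; apply: le_trans square_gap.
by rewrite leeDl// kernel_interaction_ge0.
Qed.

End energy_gap.

(** * Bounds on overlaps *)

Section overlap_bound.
Context {R : realType}.
Notation mu := (@lebesgue_measure R).
Notation mu2 := (@plane_measure R).
Notation P2 := (measurableTypeR R * measurableTypeR R)%type.
Implicit Types (r w : R) (x z : R * R).
Local Open Scope ereal_scope.

Definition strip r w : set P2 := [set x : P2 | `|x.1| <= r /\ `|x.2 - x.1| <= w]%R.

Lemma measurable_strip r w : measurable (strip r w).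
Proof.
apply: measurableI.
- have ms : measurable_fun [set: P2] (fun x : P2 => (`|x.1| <= r)%R).
    by apply: measurable_fun_ler => //; apply: measurableT_comp.
  by rewrite -[X in measurable X]setTI; exact: (ms _ [set true]).
- have ms : measurable_fun [set: P2] (fun x : P2 => (`|x.2 - x.1| <= w)%R).
    apply: measurable_fun_ler => //; apply: measurableT_comp => //.
    exact: measurable_funB.
  by rewrite -[X in measurable X]setTI; exact: (ms _ [set true]).
Qed.

(** Each vertical section over [[-r, r]] is an interval of length [2 w]. *)
Lemma plane_measure_strip r w : (0 <= r)%R -> (0 <= w)%R ->
  mu2 (strip r w) <= (4 * r * w)%:E.
Proof.
move=> r0 w0.
have mI : measurable (`[(- r)%R, r]%classic : set (measurableTypeR R)).
  exact: measurable_itv.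
rewrite [leLHS](_ : _ = \int[mu]_(x in `[(- r)%R, r]) (2 * w)%:E).
  apply: (@le_trans _ _ ((2 * w)%:E * mu `[(- r)%R, r]%classic)).
    by rewrite (integral_cst mu mI).
  rewrite lebesgue_measure_itv/=; case: ifP => _.
    by rewrite -EFinB -EFinM lee_fin; lra.
  by rewrite mule0 lee_fin !mulr_ge0.
transitivity (\int[mu]_x mu (xsection (strip r w) x)) => //.
rewrite [RHS]integral_mkcond; apply: eq_integral => x _.
rewrite patchE; case: ifPn => [|/negP]; rewrite inE/= in_itv/= -ler_norml => xr.
  rewrite (_ : xsection _ _ = `[(x - w)%R, (x + w)%R]%classic).
    rewrite lebesgue_measure_itv/= lte_fin; case: ifP => xw.
      by rewrite -EFinB; congr EFin; ring.
    by congr EFin; lra.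
  apply/seteqP; split => y; rewrite /xsection/= inE /strip/= in_itv/=.
    by move=> [_]; rewrite ler_norml => /andP[? ?]; apply/andP; split; lra.
  by move=> /andP[? ?]; split => //; rewrite ler_norml; apply/andP; split; lra.
rewrite (_ : xsection _ _ = set0) ?measure0//.
by rewrite -subset0 => y; rewrite /xsection/= inE => -[].
Qed.

Lemma ler_norm_enorm x : (`|x.1| <= enorm x)%R /\ (`|x.2| <= enorm x)%R.
Proof.
by split; rewrite -sqrtr_sqr ler_wsqrtr// (lerDl, lerDr) sqr_ge0.
Qed.

(** A neighbourhood, inside a box, of the two diagonals that bound the cross. *)
Definition near_cross r w : set P2 :=
  [set x : P2 | [/\ `|x.1| <= r, `|x.2| <= r & `| `|x.1| - `|x.2| | <= w]%R].

(** The first bound is the area of the box, the second that of two strips, one along each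
    diagonal. *)
Lemma plane_measure_near_cross r w (X : set P2) : (0 <= r)%R -> (0 <= w)%R ->
  measurable X -> X `<=` near_cross r w ->
  mu2 X <= (4 * r * r)%:E /\ mu2 X <= (8 * r * w)%:E.
Proof.
move=> r0 w0 mX XN; split.
  pose I : set (measurableTypeR R) := `[(- r)%R, r]%classic.
  have mI : measurable I by exact: measurable_itv.
  apply: (@le_trans _ _ (mu2 (I `*` I))).
    apply: le_measure; rewrite ?inE//; first exact: measurableX.
    by move=> x /XN[x1 x2 _]; split; rewrite /I/= in_itv/= -ler_norml.
  rewrite plane_measureX// /I lebesgue_measure_itv/=; case: ifP => _.
    by rewrite -EFinB -EFinM lee_fin; lra.
  by rewrite mule0 lee_fin !mulr_ge0.
(* The map [f] changes the sign of the first coordinate and exchanges the diagonals; adding 0 serves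
   as the identity on the second coordinate. *)
have [mf fE] := measure_preserving_pair measure_preserving_opp
  (measure_preserving_add (0 : R)%R).
set f := (fun x : R * R => _) in mf fE.
have ms := measurable_strip r w.
have mfs : measurable (f @^-1` strip r w).
  by rewrite -[X in measurable X]setTI; exact: mf.
apply: (@le_trans _ _ (mu2 (strip r w `|` f @^-1` strip r w))).
  apply: le_measure; rewrite ?inE//; first exact: measurableU.
  move=> x /XN[x1 _ +]; rewrite ler_norml => /andP[].
  have [h1|h1] := ger0P x.1; have [h2|h2] := ger0P x.2 => h3 h4.
  - left; split => //; rewrite ler_norml; apply/andP; split; lra.
  - right; split; rewrite /f/= ?normrN// add0r opprK ler_norml; apply/andP; split; lra.
  - right; split; rewrite /f/= ?normrN// add0r opprK ler_norml; apply/andP; split; lra.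
  - left; split => //; rewrite ler_norml; apply/andP; split; lra.
apply: (le_trans (measureU2 _ ms mfs)).
have h1 := plane_measure_strip r0 w0.
have h2 : mu2 (f @^-1` strip r w) <= (4 * r * w)%:E.
  by apply: le_trans h1; rewrite le_eqVlt; apply/orP; left; apply/eqP; exact: fE.
by apply: le_trans (leeD h1 h2) _; rewrite -EFinD lee_fin; lra.
Qed.

(** For [|z| >= 1] use the box bound, otherwise the strip bound with [|z.1| + |z.2| <= 2 |z|]. The
    result is a multiple of the weight against which the kernel is integrable. *)
Lemma overlap_near_cross r (A B : set P2) z : (0 < r)%R ->
  measurable A -> measurable B ->
  (forall x, A x -> B (x - z)%R -> near_cross r (`|z.1| + `|z.2|)%R x) ->
  overlap A B z <= ((4 * r * r + 16 * r) * Num.min 1 (enorm z))%:E.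
Proof.
move=> r0 mA mB AB; have r0' := ltW r0.
have w0 : (0 <= `|z.1| + `|z.2|)%R by rewrite addr_ge0.
have [h1 h2] := @plane_measure_near_cross r _ _ r0' w0
  (measurable_overlap_set z mA mB) (fun x '(conj Ax Bx) => AB x Ax Bx).
have [z1 z2] := ler_norm_enorm z.
have [z01|z01] := leP 1%R (enorm z).
  apply: le_trans h1 _; rewrite lee_fin mulr1 lerDl; lra.
apply: le_trans h2 _; rewrite lee_fin.
have rr : (0 <= r * r)%R by rewrite mulr_ge0.
have : (r * (`|z.1| + `|z.2|) <= r * (2 * enorm z))%R.
  by rewrite ler_wpM2l//; lra.
have : (0 <= r * r * enorm z)%R by rewrite mulr_ge0// sqrtr_ge0.
lra.
Qed.

Variable r : R.
Hypothesis r0 : (0 < r)%R.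
Notation C := (4 * r * r + 16 * r)%R.
Notation E := (cross : set P2).
Notation B := (@eball R r : set P2).

(** From [x] in the cross to [x - z] outside it, [|x.1| - |x.2|] changes sign, and the shift changes
    it by at most [|z.1| + |z.2|]. *)
Lemma overlap_cross_ball z :
  overlap (E `&` B) (~` E) z <= (C * Num.min 1 (enorm z))%:E.
Proof.
have mE := @measurable_cross R; have mB := @measurable_eball R r.
apply: overlap_near_cross => //.
- exact: measurableI.
- exact: measurableC.
move=> x [Ex Bx] /= nE; have [x1 x2] := ler_norm_enorm x.
move: Ex nE Bx; rewrite /cross/eball/= => Ex /negP; rewrite -ltNge => nE Bx.
split; [lra|lra|]; rewrite ler_norml; apply/andP.
have := ler_normD (x.1 - z.1)%R z.1; rewrite subrK => ?.
have := ler_normB x.2 z.2 => ?; split; lra.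
Qed.

(** The piece inside the ball comes first so that [x] is bounded; this is the second perimeter term
    with its arguments exchanged. *)
Lemma overlap_ball_cross z :
  overlap (B `\` E) (E `\` B) z <= (C * Num.min 1 (enorm z))%:E.
Proof.
have mE := @measurable_cross R; have mB := @measurable_eball R r.
apply: overlap_near_cross => //.
- exact: measurableD.
- exact: measurableD.
move=> x [Bx nE] /= [Ex _]; have [x1 x2] := ler_norm_enorm x.
move: Ex nE Bx; rewrite /cross/eball/= => Ex /negP; rewrite -ltNge => nE Bx.
split; [lra|lra|]; rewrite ler_norml; apply/andP.
have := ler_normD (x.2 - z.2)%R z.2; rewrite subrK => ?.
have := ler_normB x.1 z.1 => ?; split; lra.
Qed.

(** The midpoint [z / 2] lies in the open square and [z / 2 - z] in the opposite one, so a small box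
    around [z / 2] is contained in the overlap set. *)
Lemma overlap_square_gt0 m z :
  (0 < z.2 + z.1 < 2 * m)%R -> (0 < z.2 - z.1 < 2 * m)%R ->
  0 < overlap (square m) (nsquare m) z.
Proof.
move=> /andP[u0 u1] /andP[v0 v1].
have mS := measurable_square m; have mS' := measurable_nsquare m.
have [e [e0 e1 e2 e3 e4]] : exists e : R, [/\ (0 < e)%R,
    (8 * e <= z.2 + z.1)%R, (8 * e <= 2 * m - (z.2 + z.1))%R,
    (8 * e <= z.2 - z.1)%R & (8 * e <= 2 * m - (z.2 - z.1))%R].
  (* One eighth of the smallest slack: an error [e] in each coordinate moves [u] and [v] by at most
     [2 e], while [z / 2] has a margin of [4 e]. *)
  exists (Num.min (Num.min (z.2 + z.1) (2 * m - (z.2 + z.1)))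
     (Num.min (z.2 - z.1) (2 * m - (z.2 - z.1))) / 8)%R.
  set e := Num.min _ _.
  have : [/\ (e <= z.2 + z.1)%R, (e <= 2 * m - (z.2 + z.1))%R,
    (e <= z.2 - z.1)%R & (e <= 2 * m - (z.2 - z.1))%R].
    by split; rewrite /e !ge_min lexx ?orbT.
  have : (0 < e)%R by rewrite /e !lt_min !subr_gt0 u0 u1 v1 -subr_gt0 v0.
  by move=> ? [? ? ? ?]; split; lra.
pose I (c : R) : set (measurableTypeR R) := `[(c - e)%R, (c + e)%R]%classic.
have mI c : measurable (I c) by exact: measurable_itv.
have muI c : mu (I c) = (2 * e)%:E.
  rewrite /I lebesgue_measure_itv/= lte_fin ifT; last by lra.
  by rewrite -EFinB; congr EFin; ring.
apply: (@lt_le_trans _ _ (mu2 (I (z.1 / 2)%R `*` I (z.2 / 2)%R))).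
  by rewrite plane_measureX// !muI -EFinM lte_fin; apply: mulr_gt0; lra.
apply: le_measure; rewrite ?inE.
- exact: measurableX.
- exact: measurable_overlap_set.
move=> x; rewrite /I/= !in_itv/= => -[/andP[? ?] /andP[? ?]].
by split; split; rewrite /= in_itv/=; apply/andP; split; lra.
Qed.

End overlap_bound.

(** * Consequences of minimality *)

Section perimeter_increment.
Context {R : realType}.
Notation mu2 := (@plane_measure R).
Notation P2 := (measurableTypeR R * measurableTypeR R)%type.
Local Open Scope ereal_scope.
Variable k : P2 -> \bar R.
Hypotheses (mk : measurable_fun [set: P2] k) (k0 : forall z, 0 <= k z).
Hypothesis kN : {ae mu2, forall z : P2, k (- (z : R * R))%R = k z}.
Notation J := (kernel_interaction k).
Implicit Types A B E : set P2.

Lemma kernel_interaction_addl A A' B :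
  measurable A -> measurable A' -> measurable B ->
  A `&` A' = set0 -> J (A `|` A') B = J A B + J A' B.
Proof.
move=> mA mA' mB AA'.
rewrite (kernel_interactionC mk k0 kN (measurableU _ _ mA mA') mB).
rewrite (kernel_interaction_addr mk k0 mB mA mA' AA').
rewrite (kernel_interactionC mk k0 kN mA mB).
by rewrite (kernel_interactionC mk k0 kN mA' mB).
Qed.

Definition kernel_perimeter E B : \bar R :=
  J (E `&` B) (~` E) + J (E `\` B) (B `\` E).

Variables A B E : set P2.
Hypotheses (mA : measurable A) (mB : measurable B) (mE : measurable E).
Hypotheses (AB : A `<=` B) (AE : A `&` E = set0).
Notation F := (E `|` A).

(** The part common to the perimeters of [E] and [F]. *)
Let X := J (E `&` B) (~` F) + J (E `\` B) (B `\` F).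

Let mF : measurable F. Proof. exact: measurableU. Qed.
Let mFC : measurable (~` F). Proof. exact: measurableC. Qed.
Let mEB : measurable (E `&` B). Proof. exact: measurableI. Qed.
Let mEDB : measurable (E `\` B). Proof. exact: measurableD. Qed.
Let mBDF : measurable (B `\` F). Proof. exact: measurableD. Qed.

Let AnE x : A x -> E x -> False.
Proof. by move=> Ax Ex; have : (A `&` E) x by []; rewrite AE. Qed.

(** [A] belongs to the second set in both terms of the perimeter; its interactions with [E] inside
    and outside [B] add up to the one with all of [E]. *)
Lemma kernel_perimeter_before : kernel_perimeter E B = X + J A E.
Proof.
have e1 : ~` E = ~` F `|` A.
  apply/seteqP; split => x /=.
    by move=> nE; have [Ax|nA] := pselect (A x); [right|left => -[]].
  by move=> [nF|Ax] Ex; [apply: nF; left | exact: AnE Ax Ex].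
have e2 : B `\` E = (B `\` F) `|` A.
  apply/seteqP; split => x /=.
    by move=> [Bx nE]; have [Ax|nA] := pselect (A x); [right|left; split=> // -[]].
  move=> [[Bx nF]|Ax]; split => //.
  - by move=> Ex; apply: nF; left.
  - exact: AB.
  - exact: AnE Ax.
have d1 : ~` F `&` A = set0.
  by rewrite -subset0 => x [/= nF Ax]; apply: nF; right.
have d2 : (B `\` F) `&` A = set0.
  by rewrite -subset0 => x [/= [_ nF] Ax]; apply: nF; right.
have d3 : (E `&` B) `&` (E `\` B) = set0.
  by rewrite -subset0 => x [/= [_ Bx] [_ nB]].
have e4 : J (E `&` B) A + J (E `\` B) A = J A E.
  rewrite -(kernel_interaction_addl mEB mEDB mA d3) setUIDK.
  exact: (kernel_interactionC mk k0 kN mE mA).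
rewrite /kernel_perimeter e1 e2.
rewrite (kernel_interaction_addr mk k0 mEB mFC mA d1).
rewrite (kernel_interaction_addr mk k0 mEDB mBDF mA d2).
rewrite /X -e4; exact: addeACA.
Qed.

Lemma kernel_perimeter_after : kernel_perimeter F B = X + J A (~` F).
Proof.
have e1 : F `&` B = (E `&` B) `|` A.
  apply/seteqP; split => x /=.
    by move=> [[Ex|Ax] Bx]; [left|right].
  by move=> [[Ex Bx]|Ax]; split; [left|by []|right|exact: AB].
have e2 : F `\` B = E `\` B.
  apply/seteqP; split => x /=.
    by move=> [[Ex|Ax] nB]; split => //; case: nB; exact: AB.
  by move=> [Ex nB]; split=> //; left.
have d1 : (E `&` B) `&` A = set0.
  by rewrite -subset0 => x [/= [Ex _] Ax]; exact: AnE Ax Ex.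
rewrite /kernel_perimeter e1 e2.
rewrite (kernel_interaction_addl mEB mA mFC d1).
by rewrite /X; exact: addeAC.
Qed.

(** Finiteness of the perimeter makes [X] finite, so it cancels. *)
Lemma kernel_perimeter_decrease : kernel_perimeter E B < +oo ->
  kernel_perimeter E B <= kernel_perimeter F B -> J A E <= J A (~` F).
Proof.
rewrite kernel_perimeter_before kernel_perimeter_after => fin.
have X0 : 0 <= X by apply: adde_ge0; exact: kernel_interaction_ge0.
have Xfin : X \is a fin_num.
  rewrite (ge0_fin_numE X0); apply: le_lt_trans fin.
  exact: (leeDl _ (kernel_interaction_ge0 k0 A E)).
by rewrite (leeD2lE _ _ Xfin).
Qed.

End perimeter_increment.

(** * Null sets of the plane and admissibility of the competitor *)

Section cross_not_minimal.
Context {R : realType}.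
Notation mu := (@lebesgue_measure R).
Notation mu2 := (@plane_measure R).
Notation P2 := (measurableTypeR R * measurableTypeR R)%type.
Local Open Scope ereal_scope.

Lemma plane_measure_set1 (a : P2) : mu2 [set a] = 0.
Proof.
case: a => a b; rewrite (_ : [set _] = [set a] `*` [set b]).
  have -> : mu2 ([set a] `*` [set b]) = mu [set a] * mu [set b].
    by apply: plane_measureX; exact: measurable_set1.
  by rewrite !lebesgue_measure_set1 mule0.
by apply/seteqP; split => -[x y]/= [-> ->].
Qed.

Lemma ae_ne0 : {ae mu2, forall z : P2, z <> (0 : R * R)%R}.
Proof.
exists [set (0 : R * R)%R]; split.
- rewrite (_ : [set _] = [set 0%R] `*` [set 0%R]).
    by apply: measurableX; exact: measurable_set1.
  by apply/seteqP; split => -[x y]/= [-> ->].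
- exact: plane_measure_set1.
- by move=> z /= /contrapT.
Qed.

(** Within each ball the diagonals form a neighbourhood of width 0, which the strip bound makes
    null. *)
Lemma ae_off_diagonals : {ae mu2, forall z : P2, `|z.1|%R <> `|z.2|%R}.
Proof.
pose X n : set P2 := [set z : P2 | `|z.1|%R = `|z.2|%R] `&` eball n.+1%:R.
have mX n : measurable (X n).
  apply: measurableI; last exact: measurable_eball.
  have md : measurable_fun [set: P2] (fun z : P2 => `|z.1|%R == `|z.2|%R).
    by apply: measurable_fun_eqr; apply: measurableT_comp.
  rewrite [X in measurable X](_ : _ =
    (fun z : P2 => `|z.1|%R == `|z.2|%R) @^-1` [set true]).
    by rewrite -[X in measurable X]setTI; exact: (md _ [set true]).
  by apply/seteqP; split => z /= /eqP.
have X0 n : mu2.-negligible (X n).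
  apply/negligibleP => //.
  have XN : X n `<=` near_cross n.+1%:R 0.
    move=> z [/= zz zn]; have [z1 z2] := ler_norm_enorm z.
    have zn' := ltW zn.
    split; [exact: le_trans z1 zn'|exact: le_trans z2 zn'|].
    by rewrite zz subrr normr0.
  have [_] := plane_measure_near_cross (ler0n R n.+1) (lexx 0%R) (mX n) XN.
  by rewrite mulr0 => le0; apply/eqP; rewrite -measure_le0.
have := negligible_bigcup X0; apply: negligibleS => z /= /contrapT zz.
exists (Num.bound (enorm z)) => //; split => //.
rewrite /eball/=; apply: (lt_trans (archi_boundP (sqrtr_ge0 _))).
by rewrite ltr_nat.
Qed.

(** The squared norm is [(u^2 + v^2) / 2], which is below [m^2] on both squares. *)
Lemma square_sub_eball (m : R) : (0 < m)%R ->
  square m `|` nsquare m `<=` (@eball R m : set P2).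
Proof.
move=> m0.
have SB : square m `<=` @eball R m.
  move=> x; rewrite /square/rect/= !in_itv/= => -[/andP[u0 um] /andP[v0 vm]].
  have uu : ((x.2 + x.1) ^+ 2 < m ^+ 2)%R by rewrite ltr_pXn2r// nnegrE ltW.
  have vv : ((x.2 - x.1) ^+ 2 < m ^+ 2)%R by rewrite ltr_pXn2r// nnegrE ltW.
  rewrite /eball/enorm/= -(ger0_norm (ltW m0)) -sqrtr_sqr ltr_sqrt ?exprn_gt0//.
  have -> : (x.1 ^+ 2 + x.2 ^+ 2 = ((x.2 + x.1) ^+ 2 + (x.2 - x.1) ^+ 2) / 2)%R.
    by field.
  lra.
by move=> x [/SB//|/SB]; rewrite /eball/enorm/= !sqrrN.
Qed.

Lemma filled_cross_setD (m : R) : (0 < m)%R ->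
  filled_cross m `\` eball m = (cross : set P2) `\` eball m.
Proof.
move=> m0; apply/seteqP; split => x; last by move=> [Ex nB]; split => //; left.
by move=> [[Ex|/(square_sub_eball m0)//] nB]; split.
Qed.

(** * Symmetries and a Borel version of the radial kernel *)

Section radial.
Variables (K : R * R -> R) (K0 : R -> R).
Hypothesis K0_ge0 : forall t : R, (0 < t)%R -> (0 <= K0 t)%R.
Hypothesis K_radial : forall x : R * R, x != 0%R -> K x = K0 (enorm x).

Lemma radial_opp z : K (- z)%R = K z.
Proof.
have [->|z0] := eqVneq z 0%R; first by rewrite oppr0.
by rewrite !K_radial ?oppr_eq0// /enorm/= !sqrrN.
Qed.

Lemma radial_swap (z : R * R) : K (z.2, z.1) = K z.
Proof.
have [->//|z0] := eqVneq z 0%R.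
rewrite !K_radial//; first by rewrite /enorm/= addrC.
by apply: contra z0 => /eqP[z2 z1]; case: z z1 z2 => a b /= -> ->.
Qed.

Lemma enorm_gt0 (z : R * R) : z != 0%R -> (0 < enorm z)%R.
Proof.
move=> z0; have [z1 z2] := ler_norm_enorm z; rewrite lt0r sqrtr_ge0 andbT.
apply: contra z0 => /eqP e0; move: z1 z2; rewrite e0 !normr_le0 => /eqP z1 /eqP z2.
by case: z z1 z2 {e0} => a b /= -> ->.
Qed.

(** At the origin the sign of [K] is unknown, but the weight vanishes there. *)
Lemma weighted_kernel_ge0 z : (0 <= Num.min 1 (enorm z) * K z)%R.
Proof.
have [->|z0] := eqVneq z 0%R.
  by rewrite /enorm/= expr0n addr0 sqrtr0 min_r// mul0r.
have ez := enorm_gt0 z0.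
by rewrite mulr_ge0 ?K_radial// ?K0_ge0// le_min ler01 sqrtr_ge0.
Qed.

Hypothesis K_L1 : (@lebesgue2 R).-integrable [set: plane R]
            (fun x : plane R => (Num.min 1 (enorm x) * K x)%:E).

(** Integrability speaks of the weighted kernel: take a Borel version [g] of it and divide by the
    weight, which vanishes only at the origin. *)
Lemma kernel_borel_version : exists k : P2 -> \bar R,
  [/\ measurable_fun [set: P2] k, forall z, 0 <= k z,
      {ae mu2, forall z : P2, (K z)%:E = k z} &
      \int[mu2]_z (k z * (Num.min 1 (enorm z))%:E) < +oo].
Proof.
pose f (z : plane R) : \bar R := (Num.min 1 (enorm z) * K z)%:E.
have f0 z : 0 <= f z by rewrite lee_fin weighted_kernel_ge0.
have [mf foo] := integrableP _ _ _ K_L1.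
have [g [mg g0 fg]] : exists g : P2 -> \bar R, [/\ measurable_fun [set: P2] g,
    (forall x, 0 <= g x) & \forall x \ae mu2, f x = g x].
  exact: (@caratheodory_borel_version_fun _ _ _ (borel_lebesgue2 R)
    sigma_finite_plane_measure f mf f0).
have mm : measurable_fun [set: P2] (fun z : P2 => Num.min 1 (enorm z))%R.
  by apply: measurable_minr => //; exact: measurable_enorm.
have m0 (z : P2) : (0 <= Num.min 1 (enorm z))%R by rewrite le_min ler01 sqrtr_ge0.
pose w (z : P2) : R := (Num.min 1 (enorm z))^-1%R.
have mw : measurable_fun [set: P2] (fun z => (w z)%:E).
  apply/measurable_EFinP.
  (* Measurability of the inverse weight comes from that of real powers; both expressions agree on
     nonnegative reals, also at 0. *)
  rewrite (_ : w = fun z => Num.min 1 (enorm z) `^ (-1))%R.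
    exact: (measurableT_comp (measurable_powR (-1)%R) mm).
  by apply/funext => z; rewrite powR_inv1.
have mk : measurable_fun [set: P2] (fun z => g z * (w z)%:E).
  exact: emeasurable_funM.
exists (fun z => g z * (w z)%:E); split => //.
- by move=> z; rewrite mule_ge0// lee_fin invr_ge0.
- move: ae_ne0 fg; apply: filterS2 => z /eqP z0 <-; rewrite /f -EFinM; congr EFin.
  have mz : (Num.min 1 (enorm z) != 0)%R.
    by rewrite lt0r_neq0// lt_min ltr01/=; exact: enorm_gt0.
  by rewrite /w [RHS]mulrAC mulfV// mul1r.
- apply: (@le_lt_trans _ _ (\int[mu2]_z g z)).
    apply: ge0_le_integral => //.
    + by move=> z _; rewrite !mule_ge0 ?lee_fin// invr_ge0.
    + by apply: emeasurable_funM => //; exact/measurable_EFinP.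
    (* Multiplying back by the weight returns [g], except where the weight is 0: there the product
       is 0, hence only an inequality. *)
    + move=> z _; rewrite -muleA -EFinM /w.
      have [->|wz] := eqVneq (Num.min 1 (enorm z))%R 0%R.
        by rewrite mulr0 mule0.
      by rewrite mulVf// mule1.
  have E1 : \int[@lebesgue2 R]_z f z = \int[mu2]_z g z.
    exact: (@integral_completed_ae _ _ _ (borel_lebesgue2 R) f g setT
      measurableT mg g0 fg).
  have E2 : \int[@lebesgue2 R]_z `|f z| = \int[@lebesgue2 R]_z f z.
    by apply: eq_integral => z _; exact: gee0_abs.
  by rewrite -E1 -E2.
Qed.

End radial.

(** * Minimality forces the kernel to vanish on a quadrant *)

Section vanishing.
Variable k : P2 -> \bar R.
Hypotheses (mk : measurable_fun [set: P2] k) (k0 : forall z, 0 <= k z).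
Hypothesis kL1 : \int[mu2]_z (k z * (Num.min 1 (enorm z))%:E) < +oo.
Hypothesis kN : {ae mu2, forall z : P2, k (- (z : R * R))%R = k z}.
Hypothesis kS : {ae mu2, forall z : P2, k (z.2, z.1) = k z}.
Notation J := (kernel_interaction k).

Lemma kernel_interaction_lty (A B : set P2) (c : R) : (0 <= c)%R ->
  measurable A -> measurable B ->
  (forall z, overlap A B z <= (c * Num.min 1 (enorm z))%:E) -> J A B < +oo.
Proof.
move=> c0 mA mB ov.
have mm : measurable_fun [set: P2] (fun z : P2 => Num.min 1 (enorm z))%R.
  by apply: measurable_minr => //; exact: measurable_enorm.
have m0 (z : P2) : (0 <= Num.min 1 (enorm z))%R by rewrite le_min ler01 sqrtr_ge0.
have mkm : measurable_fun [set: P2] (fun z => k z * (Num.min 1 (enorm z))%:E).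
  by apply: emeasurable_funM => //; exact/measurable_EFinP.
have km0 z : 0 <= k z * (Num.min 1 (enorm z))%:E by rewrite mule_ge0// lee_fin.
apply: (@le_lt_trans _ _ (c%:E * \int[mu2]_z (k z * (Num.min 1 (enorm z))%:E))).
  rewrite -ge0_integralZl//.
  apply: ge0_le_integral.
  - exact: measurableT.
  - by move=> z _; rewrite mule_ge0// overlap_ge0.
  - by apply: emeasurable_funM => //; exact: measurable_overlap.
  - exact: measurable_funeM.
  - move=> z _; rewrite muleCA -EFinM; apply: lee_wpmul2l; [exact: k0|exact: ov].
by apply: lte_mul_pinfty.
Qed.

Lemma kernel_perimeter_cross_lty (r : R) : (0 < r)%R ->
  kernel_perimeter k cross (eball r) < +oo.
Proof.
move=> r0; have mE := @measurable_cross R; have mB := @measurable_eball R r.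
have c0 : (0 <= 4 * r * r + 16 * r)%R.
  by rewrite addr_ge0 ?mulr_ge0// ltW.
apply: lte_add_pinfty.
- apply: (kernel_interaction_lty c0 (measurableI _ _ mE mB) (measurableC mE)).
  exact: overlap_cross_ball.
(* Exchange the arguments so that the integration variable of the overlap stays in the ball. *)
- rewrite (kernel_interactionC mk k0 kN (measurableD mE mB) (measurableD mB mE)).
  apply: (kernel_interaction_lty c0 (measurableD mB mE) (measurableD mE mB)).
  exact: overlap_ball_cross.
Qed.

Hypothesis kmin : forall m : R, (0 < m)%R ->
  kernel_perimeter k cross (eball m) <= kernel_perimeter k (filled_cross m) (eball m).

(** Minimality and [energy_gap] bound the same two interactions in opposite directions, and the gap
    between them is this term. *)
Lemma square_interaction0 (m : R) : (0 < m)%R -> J (square m) (nsquare m) = 0.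
Proof.
move=> m0.
have mS := measurable_square m; have mS' := measurable_nsquare m.
have mE := @measurable_cross R; have mB := @measurable_eball R m.
have mA := measurableU _ _ mS mS'.
have AB := square_sub_eball m0.
have SE x : square m x -> ~ cross x.
  rewrite /square/rect/= !in_itv/= => -[/andP[u0 um] /andP[v0 vm]].
  rewrite /cross/=; apply/negP; rewrite -ltNge ltr_norml.
  rewrite ger0_norm; last by lra.
  by apply/andP; split; lra.
have AE : (square m `|` nsquare m) `&` cross = set0.
  rewrite -subset0 => x [/= [Sx|Sx] Ex]; first exact: SE Sx Ex.
  by apply: (SE _ Sx); move: Ex; rewrite /cross/= !normrN.
have le := kernel_perimeter_decrease mk k0 kN mA mB mE AB AE
  (kernel_perimeter_cross_lty m0) (kmin m0).
have gap := energy_gap mk k0 kN kS m0.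
have mFC := measurableC (measurable_filled_cross m).
(* By the gap inequality this is at most the interaction of the squares with the cross, itself a
   summand of the finite perimeter of the cross. *)
have fin : J (square m `|` nsquare m) (~` filled_cross m) \is a fin_num.
  rewrite (ge0_fin_numE (kernel_interaction_ge0 k0 _ _)).
  apply: le_lt_trans (kernel_perimeter_cross_lty m0).
  apply: le_trans (le_trans gap _).
    exact: (leeDl _ (kernel_interaction_ge0 k0 _ _)).
  rewrite (kernel_perimeter_before mk k0 kN mA mB mE AB AE).
  apply: leeDr; apply: adde_ge0; exact: kernel_interaction_ge0.
apply: le_anti; rewrite (kernel_interaction_ge0 k0) andbT.
by rewrite -(leeD2lE _ _ fin) adde0; exact: le_trans gap le.
Qed.

(** A nonnegative integrand with zero integral vanishes almost everywhere. Countably many squares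
    suffice, as every [z] of the quadrant has positive overlap once the square is large. *)
Lemma kernel_vanishes : {ae mu2, forall z : P2, (`|z.1| < z.2)%R -> k z = 0}.
Proof.
have ae0 n : {ae mu2, forall z : P2,
    k z * overlap (square n.+1%:R) (nsquare n.+1%:R) z = 0}.
  have mS := measurable_square n.+1%:R; have mS' := @measurable_nsquare R n.+1%:R.
  pose f z := k z * overlap (square n.+1%:R) (nsquare n.+1%:R) z.
  have f0 z : 0 <= f z by rewrite mule_ge0// overlap_ge0.
  have mf : measurable_fun [set: P2] f.
    by apply: emeasurable_funM => //; exact: measurable_overlap.
  have int0 : \int[mu2]_z `|f z| = 0.
    rewrite -(@square_interaction0 n.+1%:R)//.
    by apply: eq_integral => z _; rewrite gee0_abs.
  have [/(_ int0) + _] := ae_eq_integral_abs mu2 measurableT mf.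
  by apply: filterS => z h; exact: (h Logic.I).
have := ae_foralln ae0; apply: filterS => z kz; rewrite ltr_norml => /andP[z1 z2].
(* Both coordinates [u] and [v] are positive, so an integer above their sum bounds each of them. *)
have uv0 : (0 <= z.2 + z.1 + (z.2 - z.1))%R by lra.
have := archi_boundP uv0; set n := Num.bound _ => uvn.
have := kz n => /eqP; rewrite mule_eq0 => /orP[/eqP//|].
rewrite gt_eqF//; apply: overlap_square_gt0; rewrite -natr1;
  by apply/andP; split; lra.
Qed.

End vanishing.
End cross_not_minimal.

(** * Return to the original kernel and conclusion *)

Lemma PerE (R : realType) (K : R * R -> R)
    (k : measurableTypeR R * measurableTypeR R -> \bar R)
    (E B : set (measurableTypeR R * measurableTypeR R)) :
  measurable_fun setT k -> (forall z, 0 <= k z)%E ->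
  {ae @plane_measure R, forall z, (K z)%:E = k z} ->
  measurable E -> measurable B -> Per K E B = kernel_perimeter k E B.
Proof.
move=> mk k0 Kk mE mB; rewrite /Per /kernel_perimeter.
rewrite (interactionE mk k0 Kk (measurableI _ _ mE mB) (measurableC mE)).
by rewrite (interactionE mk k0 Kk (measurableD mE mB) (measurableD mB mE)).
Qed.

Unset Implicit Arguments.
Set Strict Implicit.

Theorem proposition1p9 (R : realType) (K : R * R -> R) (K0 : R -> R)
  (K0_ge0 : forall t : R, 0 < t -> 0 <= K0 t)
  (K_radial : forall x : R * R, x != 0 -> K x = K0 (enorm x))
  (K_L1 : (@lebesgue2 R).-integrable [set: plane R]
            (fun x : plane R => (Num.min 1 (enorm x) * K x)%:E))
  (K_neq0 : ~ {ae @lebesgue2 R, forall x : plane R, K x = 0}) :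
  ~ K_minimal K cross.
Proof.
move=> [_ Kmin]; apply: K_neq0.
have [k [mk k0 Kk kL1]] := kernel_borel_version K0_ge0 K_radial K_L1.
have KN := radial_opp K_radial; have KS := radial_swap K_radial.
have opp_pres := @measure_preserving_opp2 R.
have swap_pres := @measure_preserving_swap R.
have kN := measure_preserving_ae opp_pres Kk.
have {}kN : {ae @plane_measure R, forall z : measurableTypeR R * measurableTypeR R,
    k (- (z : R * R))%R = k z}.
  by move: kN Kk; apply: filterS2 => z <- <-; rewrite KN.
have kS := measure_preserving_ae swap_pres Kk.
have {}kS : {ae @plane_measure R, forall z : measurableTypeR R * measurableTypeR R,
    k (z.2, z.1) = k z}.
  by move: kS Kk; apply: filterS2 => z <- <-; rewrite KS.
have mE := @measurable_cross R.
have kmin (m : R) : 0 < m -> (kernel_perimeter k cross (eball m) <=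
    kernel_perimeter k (filled_cross m) (eball m))%E.
  move=> m0; have mF := measurable_filled_cross m; have mB := @measurable_eball R m.
  rewrite -(PerE mk k0 Kk mE mB) -(PerE mk k0 Kk mF mB).
  apply: (Kmin _ m0); first exact: caratheodory_measurable_mu_ext.
  exact: esym (filled_cross_setD m0).
have K_top : {ae @plane_measure R, forall z : measurableTypeR R * measurableTypeR R,
    `|z.1| < z.2 -> K z = 0}.
  have := kernel_vanishes mk k0 kL1 kN kS kmin.
  by move: Kk; apply: filterS2 => z Kkz kz /kz; rewrite -Kkz => -[].
(* Central symmetry and the coordinate swap carry the upper quadrant to the other three. *)
have K_bot := measure_preserving_ae opp_pres K_top.
have K_right := measure_preserving_ae swap_pres K_top.
have K_left := measure_preserving_ae swap_pres K_bot.
have K_vert : {ae @plane_measure R, forall z : measurableTypeR R * measurableTypeR R,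
    `|z.1| < `|z.2| -> K z = 0}.
  move: K_top K_bot; apply: filterS2 => z top bot lt12.
  have [z2|z2] := ltP 0 z.2.
    by apply: top; rewrite -(ger0_norm (ltW z2)).
  by rewrite -KN; apply: bot; rewrite /= normrN -(ler0_norm z2).
have K_hor : {ae @plane_measure R, forall z : measurableTypeR R * measurableTypeR R,
    `|z.2| < `|z.1| -> K z = 0}.
  move: K_right K_left; apply: filterS2 => z right left lt21.
  have [z1|z1] := ltP 0 z.1.
    by rewrite -KS; apply: right; rewrite /= -(ger0_norm (ltW z1)).
  by rewrite -KS -KN; apply: left; rewrite /= normrN -(ler0_norm z1).
have K0ae : {ae @plane_measure R, forall z : measurableTypeR R * measurableTypeR R,
    K z = 0}.
  (* The four open quadrants fill the plane up to the diagonals, which are null. *)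
  move: (@ae_off_diagonals R) K_vert K_hor; apply: filterS3 => z zne vert hor.
  by have [/vert|/hor|] := ltgtP `|z.1| `|z.2|.
by apply: (@negligible_completed _ _ _ (borel_lebesgue2 R)).
Qed.
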